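(* Let $\mathcal{A}$ be a finite alphabet and let $S\subseteq\mathcal{A}^{\mathbb{N}}$ be a one-sided shift-invariant set. The following are equivalent: (1) $S$ is a one-sided sofic shift, i.e. it is the set of label sequences of all one-sided infinite walks along some finite labeled directed graph $\mathcal{G}$ over $\mathcal{A}$, starting from any vertex of $\mathcal{G}$. (2) $S$ is a closed one-sided subshift that has finitely many different infinite follower sets $\overline{F}(W)$. (3) $S$ is a closed one-sided subshift that has finitely many different finite follower sets $F(W)$.
   Context: $\mathcal{A}^{\mathbb{N}}$ is the set of one-sided infinite sequences $a_0a_1a_2\cdots$ with $a_i\in\mathcal{A}$, with the product topology; $\sigma(a_0a_1a_2\cdots)=a_1a_2a_3\cdots$. A set $S\subseteq\mathcal{A}^{\mathbb{N}}$ is (one-sided) shift-invariant if $\sigma(S)\subseteq S$; a closed one-sided subshift is a closed shift-invariant subset of $\mathcal{A}^{\mathbb{N}}$. For a finite word $W$ over $\mathcal{A}$, the finite follower set $F(W)$ is the set of all finite words that directly follow an occurrence of $W$ in a member of $S$, and the infinite follower set $\overline{F}(W)$ is the set of all one-sided infinite words in $\mathcal{A}^{\mathbb{N}}$ that directly follow an occurrence of $W$ in a member of $S$. ''Finitely many different'' follower sets means that the collection of these sets, as $W$ varies over all finite words, is finite. *)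

(* Defs.v *)
From HB Require Import structures.
From mathcomp Require Import all_boot.
From mathcomp Require Import boolp classical_sets functions cardinality topology.

Set Implicit Arguments.
Unset Strict Implicit.
Unset Printing Implicit Defensive.

Local Open Scope classical_set_scope.

(* The space of one-sided sequences over A: the product topology, each factor
   A being discrete. *)
Definition infword (A : finType) : Type :=
  prod_topology (fun _ : nat => discrete_topology A).

HB.instance Definition _ (A : finType) := Nbhs.on (infword A).
HB.instance Definition _ (A : finType) := Topological.on (infword A).

Section Subshifts.
Variable A : finType.
Implicit Types (x y : infword A) (S : set (infword A)) (U W : seq A).

Definition shift x : infword A := fun i => x i.+1.

Definition shift_invariant S := shift @` S `<=` S.

Definition closed_subshift S := closed S /\ shift_invariant S.

Definition occurs_at W x n := [seq (x i : A) | i <- iota n (size W)] = W.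

Definition fin_follower S W : set (seq A) :=
  [set U | exists x n, [/\ S x, occurs_at W x n & occurs_at U x (n + size W)]].

Definition inf_follower S W : set (infword A) :=
  [set y | exists x n,
     [/\ S x, occurs_at W x n & y = iter (n + size W) shift x]].

(* Loops and parallel edges, even with equal labels, are allowed, as are
   vertices without outgoing edges. *)
Record labeled_graph := LabeledGraph {
  vertex : finType;
  edge : finType;
  source : edge -> vertex;
  target : edge -> vertex;
  label : edge -> A }.

Definition infinite_walk (G : labeled_graph) (v : vertex G)
    (w : nat -> edge G) :=
  source (w 0) = v /\ forall i, target (w i) = source (w i.+1).

Definition label_sequences (G : labeled_graph) : set (infword A) :=
  [set x | exists (v : vertex G) (w : nat -> edge G),
     infinite_walk v w /\ forall i, x i = label (w i)].

Definition sofic S := exists G : labeled_graph, S = label_sequences G.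

End Subshifts.

(* Main.v *)
Require Import Defs.
From mathcomp Require Import all_boot.
From mathcomp Require Import boolp classical_sets functions cardinality topology.

Set Implicit Arguments.
Unset Strict Implicit.
Unset Printing Implicit Defensive.

Local Open Scope classical_set_scope.

(* If S is read off a graph, an infinite follower set depends only on the set
   of vertices that can be reached by reading W, which leaves finitely many
   possibilities, and S is closed by Koenig's lemma. The finite follower set is
   the set of prefixes of the infinite one. Conversely, F(Wa) is determined by
   F(W) and a, so the finite follower sets are the vertices of a graph with an
   a-labelled edge from F(W) to F(Wa) whenever F(Wa) is nonempty; every prefix
   of a label sequence of this graph occurs in S, and S is closed. *)

(** * Cylinder sets, occurrences and follower sets *)

Section Prefixes.
Variable A : finType.
Implicit Types (x y : infword A) (S : set (infword A)) (U V W : seq A).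

Definition agree N x y := forall i, i < N -> x i = y i.

Lemma nbhs_agree N x : nbhs x (agree N x).
Proof.
elim: N => [|N IHN]; first by apply: filterS filterT.
have xN : nbhs x ((fun y : infword A => y N) @^-1` [set x N]).
  exact: (@proj_continuous nat (fun=> discrete_topology A) N x _
    (discrete_set1 _)).
apply: filterS (filterI IHN xN) => y [xy /= yN] i.
by rewrite ltnS leq_eqVlt => /orP[/eqP->|/xy].
Qed.

(** The cylinders around [x] are a base of a filter [F], and convergence of [F] to [x] in a product
    topology can be tested one coordinate at a time. *)
Lemma nbhs_agree_sub x (B : set (infword A)) :
  nbhs x B -> exists N, agree N x `<=` B.
Proof.
pose F : set_system (infword A) := filter_from [set: nat] (agree^~ x).
have FF : Filter F.
  apply: filter_from_filter; first by exists 0.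
  move=> i j _ _; exists (maxn i j) => // y xy.
  by split=> k ki; apply: xy; rewrite leq_max ki ?orbT.
suff /[apply] : F --> x by case=> N _; exists N.
apply/cvg_sup => i; apply/cvg_image.
  by apply/seteqP; split=> // a _; exists (fun=> a).
(* [C] contains [x i], and every member of the cylinder of length [i.+1] has this same letter at
   [i]. *)
move=> C /nbhs_singleton Cx; exists [set y : infword A | C (y i)].
  by exists i.+1 => // y xy /=; rewrite -xy.
by apply/seteqP; split=> [_ [y Cy <-]//|a Ca]; exists (fun=> a).
Qed.

Lemma closed_agreeP S :
  closed S <-> forall x, (forall N, exists2 y, S y & agree N x y) -> S x.
Proof.
split=> [clS x xS|clS x xS].
  apply: clS => B /nbhs_agree_sub[N xB].
  by have [y Sy xy] := xS N; exists y; split=> //; exact: xB.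
by apply: clS => N; have [y [Sy xy]] := xS _ (nbhs_agree N x); exists y.
Qed.

Lemma iter_shiftE n x i : iter n (@shift A) x i = x (n + i).
Proof. by elim: n i => //= n IHn i; rewrite /shift IHn addnS. Qed.

Lemma iter_shift_invariant S n x :
  shift_invariant S -> S x -> S (iter n (@shift A) x).
Proof.
move=> S_inv Sx; elim: n => //= n IHn; apply: S_inv.
by exists (iter n (@shift A) x).
Qed.

Lemma occurs_at_cat W U x n :
  occurs_at (W ++ U) x n <-> occurs_at W x n /\ occurs_at U x (n + size W).
Proof.
rewrite /occurs_at size_cat iotaD map_cat; split=> [/eqP|[-> ->]//].
by rewrite eqseq_cat ?size_map ?size_iota// => /andP[/eqP-> /eqP->].
Qed.

Lemma occurs_at_iter_shift W x n m :
  occurs_at W (iter n (@shift A) x) m <-> occurs_at W x (n + m).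
Proof.
rewrite /occurs_at iotaDl -map_comp.
by under eq_map do rewrite iter_shiftE.
Qed.

Lemma occurs_at_prefix x N : occurs_at [seq x i | i <- iota 0 N] x 0.
Proof. by rewrite /occurs_at size_map size_iota. Qed.

Lemma occurs_prefix_agree x y N n :
  occurs_at [seq x i | i <- iota 0 N] y n ->
  agree N x (iter n (@shift A) y).
Proof.
rewrite /occurs_at size_map size_iota => e i iN; rewrite iter_shiftE.
move/(congr1 (nth (x 0) ^~ i)): e.
by rewrite !(nth_map 0) ?size_iota// !nth_iota.
Qed.

Lemma fin_followerP S W U :
  fin_follower S W U <-> exists x n, S x /\ occurs_at (W ++ U) x n.
Proof.
split=> [[x [n [Sx xW xU]]]|[x [n [Sx /occurs_at_cat[xW xU]]]]].
  by exists x, n; split=> //; apply/occurs_at_cat.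
by exists x, n.
Qed.

(** With a one-letter [U], this is what lets follower sets serve as vertices: the successor set
    depends on [W] only through its own follower set. *)
Lemma fin_follower_cat S W U :
  fin_follower S (W ++ U) = [set V | fin_follower S W (U ++ V)].
Proof.
by apply/seteqP; split=> V /=; rewrite !fin_followerP catA.
Qed.

Lemma fin_follower_inf S W :
  fin_follower S W =
  [set U | exists2 y, inf_follower S W y & occurs_at U y 0].
Proof.
apply/seteqP; split=> U.
  move=> [x [n [Sx xW xU]]]; exists (iter (n + size W) (@shift A) x).
    by exists x, n.
  by apply/occurs_at_iter_shift; rewrite addn0.
move=> [y [x [n [Sx xW ->]]] /occurs_at_iter_shift].
by rewrite addn0 => xU; exists x, n.
Qed.

Lemma finite_fin_follower S :
  finite_set (range (inf_follower S)) -> finite_set (range (fin_follower S)).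
Proof.
pose g (Y : set (infword A)) := [set U | exists2 y, Y y & occurs_at U y 0].
move=> /(finite_image g); apply: sub_finite_set => _ [W _ <-].
by rewrite fin_follower_inf; exists (inf_follower S W) => //; exists W.
Qed.

End Prefixes.

(** * The graph of finite follower sets *)

Section FollowerGraph.
Variables (A : finType) (s : seq (set (seq A))).

(** Membership of [[::]] stands for nonemptiness: for the follower set of a word, both say that the
    word occurs. The boolean form makes the edges a finite type. *)
Definition follower_edge (p : seq_sub s * A * seq_sub s) :=
  `[< ssval p.2 = [set U | ssval p.1.1 (p.1.2 :: U)] /\ ssval p.2 [::] >].

Definition follower_graph : labeled_graph A :=
  @LabeledGraph A (seq_sub s) {p | follower_edge p}
    (fun e => (val e).1.1) (fun e => (val e).2) (fun e => (val e).1.2).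

(** Each edge takes the left quotient by its label, so [k] edges take the left quotient by the word
    read. *)
Lemma follower_walk v (w : nat -> edge follower_graph) k :
  infinite_walk v w ->
  ssval (source (w k)) =
  [set U | ssval v ([seq label (w i) | i <- iota 0 k] ++ U)].
Proof.
move=> [w0 wS]; elim: k => [|k IHk]; first by rewrite w0.
have -> : [seq label (w i) | i <- iota 0 k.+1] =
    [seq label (w i) | i <- iota 0 k] ++ [:: label (w k)].
  by rewrite -addn1 iotaD map_cat.
rewrite -wS; have [-> _] := asboolP _ (valP (w k)).
rewrite -[(val (w k)).1.1]/(source (w k)) IHk.
by apply/seteqP; split=> U /=; rewrite -catA.
Qed.

(** The target of edge [k] is the quotient of [v] by the first [k.+1] labels, and it contains the
    empty word. *)
Lemma follower_walk_prefix v (w : nat -> edge follower_graph) k :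
  infinite_walk v w -> ssval v [seq label (w i) | i <- iota 0 k.+1].
Proof.
move=> wv; have [_] := asboolP _ (valP (w k)).
rewrite -[(val (w k)).2]/(target (w k)) wv.2 (follower_walk _ wv) /=.
by rewrite cats0.
Qed.

End FollowerGraph.

Lemma sofic_finite_follower (A : finType) (S : set (infword A)) :
  closed_subshift S -> finite_set (range (fin_follower S)) -> sofic S.
Proof.
move=> [/closed_agreeP clS S_inv] /finite_seqP[s sE].
have s_mem W : fin_follower S W \in s.
  by have : range (fin_follower S) (fin_follower S W) by []; rewrite sE.
exists (follower_graph s); apply/seteqP; split=> x.
  (* The walk labelled [x] visits the follower sets of the prefixes of [x]; these are nonempty
     because [x] itself contains the prefixes. *)
  move=> Sx; pose W k := [seq x i : A | i <- iota 0 k].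
  have WS k : W k.+1 = W k ++ [:: x k] by rewrite /W -addn1 iotaD map_cat.
  pose v k := SeqSub (s_mem (W k)).
  have ok k : follower_edge (v k, x k : A, v k.+1).
    apply/asboolP; split; first by rewrite /= WS fin_follower_cat.
    apply/fin_followerP; exists x, 0; split=> //; rewrite cats0.
    exact: occurs_at_prefix.
  by exists (v 0), (fun k => Sub (v k, x k : A, v k.+1) (ok k)).
move=> [v [w [wv xw]]]; apply: clS => N.
(* [v] is the follower set of some [W], so the first labels of the walk follow [W] in a member of
   [S]; shifting past [W] brings them to the origin. *)
have := follower_walk_prefix N wv.
have : range (fin_follower S) (ssval v) by rewrite sE; apply: valP.
move=> [W _ <-] /fin_followerP[y [n [Sy /occurs_at_cat[_ yw]]]].
exists (iter (n + size W) (@shift A) y); first exact: iter_shift_invariant.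
have xy : agree N.+1 x (iter (n + size W) (@shift A) y).
  by apply: occurs_prefix_agree; rewrite (eq_map xw).
by move=> i iN; apply: xy; exact: ltnW.
Qed.

(** The pigeonhole step of Koenig's lemma: if every [t] failed at some [f t], then by monotonicity
    none would hold at the largest [f t]. *)
Lemma finType_uniform_exists (T : finType) (P : nat -> T -> Prop) :
  (forall M N t, M <= N -> P N t -> P M t) -> (forall N, exists t, P N t) ->
  exists t, forall N, P N t.
Proof.
move=> Pmono Pex; apply: contrapT => nP.
have /choice[f nPf] t : exists N, ~ P N t.
  by apply/existsNP => Pt; apply: nP; exists t.
have [t Pt] := Pex (\max_t f t); apply: (nPf t).
by apply: Pmono Pt; exact: leq_bigmax.
Qed.

(** * Label sequences of a graph: closedness and infinite follower sets *)

Section LabelSequences.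
Variables (A : finType) (G : labeled_graph A).

Lemma infinite_walk_shift v (w : nat -> edge G) n :
  infinite_walk v w -> infinite_walk (source (w n)) (fun i => w (n + i)).
Proof. by move=> [_ wS]; split=> [|i]; rewrite ?addn0// addnS. Qed.

Definition walk_cat n (w1 w2 : nat -> edge G) i :=
  if i < n then w1 i else w2 (i - n).

Lemma infinite_walk_cat v n (w1 w2 : nat -> edge G) :
  infinite_walk v w1 -> infinite_walk (source (w1 n)) w2 ->
  infinite_walk v (walk_cat n w1 w2).
Proof.
rewrite /walk_cat => -[w1v w1S] [w2v w2S]; split.
  by case: n w2v => //= ->.
move=> i; case: (ltngtP i.+1 n) => [lt_in|lt_ni|in_eq].
- by rewrite w1S.
- by rewrite subSn.
- by rewrite in_eq subnn w2v -in_eq w1S.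
Qed.

(* [good k e] says that arbitrarily long stretches of x read
   from position k label walks starting with e; such an edge exists at k = 0
   and always has a successor that is good at k + 1. *)
Lemma closed_label_sequences : closed (@label_sequences A G).
Proof.
apply/closed_agreeP => x xG.
pose long k N e := exists w : nat -> edge G, [/\ w 0 = e,
  infinite_walk (source e) w & forall i, i <= N -> x (k + i) = label (w i)].
pose good k e := forall N, long k N e.
have long_mono k M N e : M <= N -> long k N e -> long k M e.
  move=> MN [w [w0 we xw]]; exists w; split=> // i iM.
  by apply: xw; exact: leq_trans MN.
have [e0 e0P] : exists e, good 0 e.
  apply: finType_uniform_exists => [M N e|N]; first exact: long_mono.
  have [y [v [w [wv yw]]] xy] := xG N.+1.
  exists (w 0), w; split=> //; first by split; [|exact: wv.2].
  by move=> i iN; rewrite xy// yw.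
have next k e : exists e', good k e -> good k.+1 e' /\ target e = source e'.
  have [ge|nge] := pselect (good k e); last by exists e.
  suff [e' e'P] : exists e', forall N, long k.+1 N e' /\ target e = source e'.
    by exists e' => _; split=> [N|]; [exact: (e'P N).1|exact: (e'P 0).2].
  apply: finType_uniform_exists => [M N e' MN [le' te]|N].
    by split=> //; exact: long_mono le'.
  (* Dropping the first edge of a stretch costs one letter, hence [N.+1]; the second edge is the
     candidate. *)
  have [w [w0 we xw]] := ge N.+1; exists (w 1); split; last first.
    by rewrite -w0 we.2.
  exists (fun i => w (1 + i)); split=> //; first exact: infinite_walk_shift we.
  by move=> i iN; rewrite addSnnS xw.
have /choice[f fP] : forall ke : nat * edge G, exists e',
    good ke.1 ke.2 -> good ke.1.+1 e' /\ target ke.2 = source e'.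
  by move=> [k e]; exact: next.
pose w := fix w k := if k is k'.+1 then f (k', w k') else e0.
have wP k : good k (w k) by elim: k => //= k /(fP (k, w k))[].
exists (source e0), w; split; first split=> // k.
  by have [] := fP (k, w k) (wP k).
move=> k; have [w' [w'0 _ /(_ 0 isT)]] := wP k 0.
by rewrite addn0 w'0.
Qed.

(** The state set of the subset construction. Reading may begin at any position [n], as occurrences
    in a follower set do. *)
Definition reaches (W : seq A) (v : vertex G) :=
  exists (u : vertex G) (w : nat -> edge G) n, [/\ infinite_walk u w,
    occurs_at W (fun i => label (w i)) n & v = source (w (n + size W))].

(** The future of a walk depends only on its current vertex, so any walk from a reached [v] can be
    spliced onto a walk that has just read [W]. *)
Lemma inf_follower_label_sequences W :
  inf_follower (@label_sequences A G) W =
  [set y | exists v (w : nat -> edge G),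
     [/\ reaches W v, infinite_walk v w & forall i, y i = label (w i)]].
Proof.
apply/seteqP; split=> y.
  move=> [x [n [[v [w [wv xw]]] xW ->]]].
  exists (source (w (n + size W))), (fun i => w (n + size W + i)); split.
  - exists v, w, n; split=> //.
    by rewrite /occurs_at -(eq_map xw).
  - exact: infinite_walk_shift wv.
  - by move=> i; rewrite iter_shiftE xw.
move=> [v [w [[u [w' [n [w'u w'W vE]]]] wv yw]]]; set m := n + size W in vE.
exists (fun i => label (walk_cat m w' w i)), n; split.
- exists u, (walk_cat m w' w); split=> //.
  by apply: infinite_walk_cat; rewrite -?vE.
- apply: etrans w'W; apply/eq_in_map => i.
  by rewrite mem_iota => /andP[_ im]; rewrite /walk_cat im.
- apply/funext => i; rewrite iter_shiftE yw /walk_cat.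
  by rewrite ltnNge leq_addr addKn.
Qed.

Lemma finite_inf_follower_label_sequences :
  finite_set (range (inf_follower (@label_sequences A G))).
Proof.
pose g (X : {set vertex G}) : set (infword A) :=
  [set y | exists v (w : nat -> edge G),
     [/\ v \in X, infinite_walk v w & forall i, y i = label (w i)]].
(* Every follower set is [g] of a subset of [vertex G], and there are finitely many subsets. *)
apply: sub_finite_set (finite_image g (@finite_finset _ setT)) => _ [W _ <-].
exists (finset (fun v => `[< reaches W v >])) => //.
rewrite inf_follower_label_sequences.
apply/seteqP; split=> y [v [w [vW wv yw]]]; exists v, w; split=> //.
  by rewrite inE in vW; apply/asboolP.
by rewrite inE; apply/asboolP.
Qed.

End LabelSequences.

Theorem mainTheorem11 (A : finType) (S : set (infword A))
    (S_inv : shift_invariant S) :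
  [<-> sofic S;
       closed_subshift S /\ finite_set (range (inf_follower S));
       closed_subshift S /\ finite_set (range (fin_follower S))].
Proof.
tfae.
- move=> [G SE]; split; last first.
    by rewrite SE; exact: finite_inf_follower_label_sequences.
  by split=> //; rewrite SE; exact: closed_label_sequences.
- by move=> [cS fS]; split=> //; exact: finite_fin_follower.
- by move=> [cS fS]; exact: sofic_finite_follower.
Qed.
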